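(* Let $G$ be a finite non-abelian nilpotent group with $|cent(G)|=n$. Let $p_1,\dots,p_m$ be the distinct primes $p_i$ for which $G$ has a non-abelian Sylow $p_i$-subgroup (so $m$ is the number of non-abelian Sylow subgroups of $G$), and let $p=\min\{p_1,\dots,p_m\}$. Then the derived length $d(G)$ of $G$ satisfies $$d(G)\leq 2+[\log_p n]-\sum_{i=1}^{m-1}[\log_p (p_i+1)].$$
   Context: For a group $G$ and $x\in G$, $C_G(x)=\{g\in G\mid gx=xg\}$ is the centralizer of $x$ in $G$, and $cent(G)=\{C_G(x)\mid x\in G\}$ denotes the set of all centralizers of elements of $G$; $G$ is called a $\mathcal{C}_n$-group if $|cent(G)|=n$. $[x]$ denotes the integer part of the real number $x$. *)

(* Defs.v *)
From mathcomp Require Import all_boot all_order all_algebra all_fingroup.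
From mathcomp Require Import all_solvable.
From mathcomp Require Import reals exp.

Set Implicit Arguments.
Unset Strict Implicit.
Unset Printing Implicit Defensive.

Import Order.TTheory GRing.Theory Num.Theory.

Definition centralizers (gT : finGroupType) (G : {group gT}) : {set {set gT}} :=
  [set 'C_G[x]%g | x in G].

(* Encoded like nil_class: the least n such that G^`(n) = 1 when G is solvable
   (see der_lengthP), and #|G| otherwise. *)
Definition derived_length (gT : finGroupType) (G : {group gT}) : nat :=
  index 1%g (mkseq (fun n => G^`(n)%g) #|G|).

Definition has_nonabelian_Sylow (gT : finGroupType) (G : {group gT}) (q : nat)
    : Prop :=
  prime q /\ exists P : {group gT}, (q.-Sylow(G) P)%g /\ ~~ abelian P.

(* The real logarithm in base b; meaningful for 0 < b != 1 and 0 < x. *)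
Definition log_base (R : realType) (b x : R) : R := (ln x / ln b)%R.

Section DerivedLength.

Local Open Scope group_scope.

Variables (gT : finGroupType) (G : {group gT}).
Hypothesis solG : solvable G.

Lemma derived_length_ltn : derived_length G < #|G|.
Proof.
suff /index_ltn : 1 \in take #|G| (mkseq (fun n => G^`(n)) #|G|) by [].
rewrite take_oversize ?size_mkseq //; apply/mapP.
have key n : n < #|G| -> (exists2 k, k < #|G| & G^`(k) = 1)
    \/ #|G^`(n)| + n <= #|G|.
  elim: n => [|n IHn] ltnG; first by right; rewrite derg0 addn0.
  have [|le_n] := IHn (ltnW ltnG); first by left.
  have [Gn1 | ntGn] := eqVneq G^`(n) 1.
    by left; exists n => //; exact: ltnW.
  right; apply: leq_trans le_n; rewrite addnS -addSn leq_add2r.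
  by apply/proper_card/(sol_der1_proper solG (der_sub n G) ntGn).
have ltG : #|G|.-1 < #|G| by rewrite prednK.
have [[k ltk Gk1] | le1] := key _ ltG.
  by exists k; rewrite ?mem_iota.
exists #|G|.-1; rewrite ?mem_iota //; apply/esym/card_le1_trivg.
by rewrite -(leq_add2r #|G|.-1) add1n prednK.
Qed.

Lemma der_lengthP n : reflect (G^`(n) = 1) (derived_length G <= n).
Proof.
have := derived_length_ltn; rewrite /derived_length; set s := mkseq _ _.
set d := index 1 s => lt_d_G; case: leqP => [le_d_n | lt_n_d].
  have Gd1 : nth 1 s d = 1 by rewrite nth_index // -index_mem size_mkseq.
  left; rewrite nth_mkseq // in Gd1; rewrite -(subnK le_d_n).
  by elim: (n - d) => [|k IHk] //; rewrite addSn dergSn IHk comm1G.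
right; apply/eqP/negPf; rewrite -(before_find 1 lt_n_d) nth_mkseq //.
exact: ltn_trans lt_n_d lt_d_G.
Qed.

End DerivedLength.

(* Main.v *)
Require Import Defs.
From mathcomp Require Import all_boot all_order all_algebra all_fingroup.
From mathcomp Require Import all_solvable.
From mathcomp Require Import reals exp.

(** Let P be a q-group with N centralizers, and let q ^ k be the largest power
    of q below N. The conjugates of a proper centralizer 'C_P[x] are themselves
    proper centralizers, so 'N_P('C_P[x]) has index at most N - 1 < q ^ k.+1 in
    P. A subgroup of a q-group of index q ^ a is reached from the top by a steps
    that are normal of index q, hence contains the a-th derived subgroup.
    Therefore P^`(k) normalizes every centralizer. If x and y lie in P^`(k),
    then x ^ y has the same centralizer as x, so it commutes with x: the group
    P^`(k) is a 2-Engel group, and 2-Engel groups are metabelian (Levi; lemma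
    engel2_metabelian). This gives P^`(k.+2) = 1 with q ^ k < N
    (pgroup_der_centralizers).

    For nilpotent G, intersecting a centralizer of G with the Sylow subgroups
    yields every family of centralizers of the Sylow subgroups, so the number n
    of centralizers of G is at least the product of the numbers N_i for its
    nonabelian Sylow subgroups (leq_prod_centralizers), while the derived length
    of G is the largest of theirs, at most k.+2 where k is the largest of the
    exponents k_i above, attained at some index j.

    A nonabelian q-group has more than q centralizers
    (pgroup_leq_centralizers), hence N_i >= p_i + 1 for all i. It remains to see
    that p ^ k times the product of the p_i + 1, with an arbitrary index l left
    out, is at most the product of the N_i (leq_prod_but_one). For j = l this is
    clear. For j <> l and k = 0 the bounds N_i >= p_i + 1 suffice; for j <> l
    and k > 0 the factor N_l >= p + 1 is spare, N_j >= p_j ^ k + 1, and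
    (p + 1) (p_j ^ k + 1) >= p ^ k (p_j + 1) because p <= p_j. Taking logarithms
    finishes the proof, since a sum of floors is at most the floor of the
    sum. *)

Set Implicit Arguments.
Unset Strict Implicit.
Unset Printing Implicit Defensive.

Import Order.TTheory GRing.Theory Num.Theory.

Local Open Scope group_scope.

(** * 2-Engel groups are metabelian *)

(** Commuting with all one's conjugates is the law [~ x, y, x] = 1, in a form
    that needs no commutator calculus. *)
Definition engel2 (gT : finGroupType) (K : {set gT}) : Prop :=
  {in K &, forall x y, commute x (x ^ y)}.

Lemma engel2_class_abelian (gT : finGroupType) (K : {group gT}) x :
  engel2 K -> x \in K -> abelian <<x ^: K>>.
Proof.
move=> EK Kx; rewrite abelian_gen.
apply/centsP=> _ /imsetP[y Ky ->] _ /imsetP[z Kz ->].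
have cx : commute x (x ^ (z * y^-1)) by apply: EK; rewrite ?groupM ?groupV.
have -> : x ^ z = (x ^ (z * y^-1)) ^ y by rewrite -conjgM mulgKV.
by rewrite /commute -!conjMg cx.
Qed.

Lemma engel2_commute (gT : finGroupType) (K : {group gT}) x y :
  engel2 K -> x \in K -> y \in K ->
  commute x [~ x, y] /\ commute y [~ x, y].
Proof.
move=> EK Kx Ky; split.
  by apply: commuteM; [apply: commuteV | exact: EK].
rewrite commgEr; apply: commuteM => //; rewrite conjVg.
by apply: commuteV; apply: EK.
Qed.

Lemma engel2_commgV (gT : finGroupType) (K : {group gT}) x y :
  engel2 K -> x \in K -> y \in K -> [~ x, y^-1] = [~ x, y]^-1.
Proof.
by move=> EK Kx Ky; apply: commgV; have [] := engel2_commute EK Kx Ky.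
Qed.

Lemma engel2_commVg (gT : finGroupType) (K : {group gT}) x y :
  engel2 K -> x \in K -> y \in K -> [~ x^-1, y] = [~ x, y]^-1.
Proof.
by move=> EK Kx Ky; apply: commVg; have [] := engel2_commute EK Kx Ky.
Qed.

(** All commutators below lie in the abelian normal closure A of x. Since
    [~ x, y * z] is fixed by y * z, expanding it shows that [~ x, z, y] is
    inverse to [~ x, y, z] ^ y; as [~ x, z, y] is fixed by y, the conjugation
    can be removed. *)
Lemma engel2_swap23 (gT : finGroupType) (K : {group gT}) x y z :
    engel2 K -> x \in K -> y \in K -> z \in K ->
  [~ x, z, y] = [~ x, y, z]^-1.
Proof.
move=> EK Kx Ky Kz.
have cA := centsP (engel2_class_abelian EK Kx).
set A := <<x ^: K>> in cA.
have nA a g : a \in A -> g \in K -> a ^ g \in A.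
  move=> Aa Kg; rewrite memJ_norm //; apply: (subsetP (norms_gen _)) Kg.
  exact: class_norm.
have rA a g : a \in A -> g \in K -> [~ a, g] \in A.
  by move=> Aa Kg; rewrite groupM ?groupV ?nA.
have Ax : x \in A by rewrite mem_gen ?class_refl.
have fixR a b : a \in K -> b \in K -> [~ a, b] ^ b = [~ a, b].
  move=> Ka Kb; have [_ cb] := engel2_commute EK Ka Kb.
  by rewrite /conjg -cb mulKg.
(* s and t are made opaque below, because conjugates and commutators unfold to
   products and would match the rules for products. *)
set s := [~ x, z, y]; set t := [~ x, y, z].
have As : s \in A by rewrite !rA.
have At : t \in A by rewrite !rA.
have fyz := fixR x (y * z) Kx (groupM Ky Kz); rewrite commgMJ in fyz.
have [ay bz] := (fixR x y Kx Ky, fixR x z Kx Kz).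
have [aZ bY] := (conjg_mulR [~ x, y] z, conjg_mulR [~ x, z] y).
have [Aa Ab] : [~ x, y] \in A /\ [~ x, z] \in A by rewrite !rA.
have sy : s ^ y = s by rewrite fixR ?groupR.
rewrite -/s -/t in aZ bY; clearbody s t; rewrite aZ in fyz.
move: [~ x, y] [~ x, z] => a b in fyz ay bz aZ bY Aa Ab *.
have zy : s ^ z * (t ^ y) ^ z = 1.
  have Asz : s ^ z \in A by rewrite nA.
  move: fyz; rewrite conjgM (conjMg b) (conjMg a) ay bY.
  rewrite (conjMg (b * s)) (conjMg b) (conjMg a) bz aZ.
  move: (s ^ z) ((t ^ y) ^ z) Asz => s' t' As'.
  rewrite -!mulgA => /mulgI; rewrite (mulgA a) mulgA (cA _ As') ?groupM //.
  by rewrite -!mulgA -{2}[t]mulg1 => /mulgI/mulgI.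
move/eqP: zy; rewrite -conjMg conjg_eq1 => /eqP sty.
have st : s * t = 1.
  by apply: (conjg_inj y); rewrite conj1g conjMg sy.
by apply: (mulIg t); rewrite st mulVg.
Qed.

Lemma engel2_swap12 (gT : finGroupType) (K : {group gT}) x y z :
    engel2 K -> x \in K -> y \in K -> z \in K ->
  [~ y, x, z] = [~ x, y, z]^-1.
Proof.
by move=> EK Kx Ky Kz; rewrite -(invg_comm x y) (engel2_commVg EK) ?groupR.
Qed.

Lemma engel2_rot (gT : finGroupType) (K : {group gT}) x y z :
    engel2 K -> x \in K -> y \in K -> z \in K ->
  [~ y, z, x] = [~ x, y, z].
Proof.
move=> EK Kx Ky Kz.
by rewrite (engel2_swap23 EK Ky Kx Kz) (engel2_swap12 EK Kx Ky Kz) invgK.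
Qed.

(** [~ x, y, z] is invariant under rotation of its arguments, and commutes with
    all of them; the three factors of the Hall-Witt identity are then equal. *)
Lemma engel2_comm3_exp3 (gT : finGroupType) (K : {group gT}) x y z :
    engel2 K -> x \in K -> y \in K -> z \in K ->
  [~ x, y, z] ^+ 3 = 1.
Proof.
move=> EK Kx Ky Kz; set f := [~ x, y, z].
have fJ w : commute w f -> f^-1 ^ w = f^-1.
  by move=> cwf; rewrite /conjg -(commuteV cwf) mulKg.
have cz : commute z f.
  by have [] := engel2_commute EK (groupR Kx Ky) Kz.
have cx : commute x f.
  have [_] := engel2_commute EK (groupR Ky Kz) Kx.
  by rewrite (engel2_rot EK Kx Ky Kz).
have cy : commute y f.
  have [_] := engel2_commute EK (groupR Kz Kx) Ky.
  by rewrite (engel2_rot EK Ky Kz Kx) // (engel2_rot EK Kx Ky Kz).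
have := Hall_Witt_identity x y z.
rewrite !(engel2_commgV EK) // !(engel2_commVg EK) ?groupR //.
rewrite (engel2_rot EK Ky Kz Kx) // (engel2_rot EK Kx Ky Kz) // -/f !fJ //.
by rewrite -!invMg => /eqP; rewrite invg_eq1 !expgS expg0 mulg1 mulgA => /eqP.
Qed.

(** Write u = [~ a, b] and v = [~ c, d]. The function [~ a, b, c, d] changes to
    its inverse under every transposition of its arguments, so the even
    permutation exchanging (a, b) with (c, d) leaves it unchanged. As it equals
    [~ u, v], this commutator is equal to [~ v, u], its own inverse. It also has
    trivial cube, hence it is trivial. *)
Lemma engel2_metabelian (gT : finGroupType) (K : {group gT}) :
  engel2 K -> K^`(2) = 1.
Proof.
move=> EK; apply/(@derG1P _ K^`(1)%G); rewrite /= abelian_gen.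
apply/centsP=> _ /imset2P[a b Ka Kb ->] _ /imset2P[c d Kc Kd ->].
set u := [~ a, b]; set v := [~ c, d].
have comm_sym e f g h : e \in K -> f \in K -> g \in K -> h \in K ->
    [~ e, f, [~ g, h]] = [~ e, f, g, h].
  move=> Ke Kf Kg Kh; have Kgh := groupR Kg Kh.
  rewrite (engel2_rot EK Kgh Ke Kf) (engel2_rot EK Ke Kg Kh).
  rewrite (engel2_swap23 EK (groupR Ke Kg) Kf Kh).
  by rewrite (engel2_swap23 EK Ke Kf Kg) (engel2_commVg EK) ?groupR ?invgK.
have uv3 : [~ u, v] ^+ 3 = 1 by rewrite (engel2_comm3_exp3 EK) ?groupR.
have uvV : [~ u, v] = [~ u, v]^-1.
  rewrite invg_comm [RHS]comm_sym // [LHS](engel2_rot EK (groupR Kc Kd) Ka Kb).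
  by rewrite -[LHS]comm_sym // -[RHS]comm_sym.
apply/commgP; move: [~ u, v] uv3 uvV => w w3 wV.
by move/eqP: w3; rewrite !expgS mulg1 {2}wV mulVg mulg1.
Qed.

(** * Derived length and centralizers of q-groups *)

Lemma der_shift (gT : finGroupType) (G H : {group gT}) k :
  G^`(1) \subset H -> G^`(k.+1) \subset H^`(k).
Proof. by move=> sGH; elim: k => // k IHk; rewrite dergSn commgSS. Qed.

(** Induction on k through a maximal subgroup M containing H: it is normal of
    index q, so that P^`(1) is contained in M, and the index of H drops by a
    factor q. *)
Lemma der_sub_index (gT : finGroupType) (P H : {group gT}) q k :
    prime q -> q.-group P -> H \subset P -> #|P : H| < q ^ k.+1 ->
  P^`(k) \subset H.
Proof.
move=> q_pr; elim: k P => [|k IHk] P qP sHP ltPH.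
all: have [<- | [M maxM sHM]] := maximal_exists sHP; first exact: der_sub.
all: have nsMP := p_maximal_normal qP maxM; have sMP := normal_sub nsMP.
all: have iMP := p_maximal_index qP maxM.
all: move: ltPH; rewrite -(Lagrange_index sMP sHM) iMP expnSr.
  by rewrite expn0 mul1n ltnNge leq_pmulr // indexg_gt0.
rewrite mulnC ltn_pmul2r ?prime_gt0 // => ltMH.
have sP'M : P^`(1) \subset M.
  rewrite der1_min ?normal_norm // cyclic_abelian // prime_cyclic //.
  by rewrite card_quotient ?normal_norm // iMP.
by apply: subset_trans (der_shift k sP'M) (IHk M _ _ _); rewrite ?(pgroupS sMP).
Qed.

Lemma cent1_conj (gT : finGroupType) (G : {group gT}) x g :
  g \in G -> 'C_G[x] :^ g = 'C_G[x ^ g].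
Proof. by move=> Gg; rewrite conjIg conjGid // -cent1J. Qed.

Lemma mem_centralizers (gT : finGroupType) (G : {group gT}) x :
  x \in G -> 'C_G[x] \in centralizers G.
Proof. by move=> Gx; apply: imset_f. Qed.

Lemma group_centralizers (gT : finGroupType) (G : {group gT}) :
  (G : {set gT}) \in centralizers G.
Proof.
by apply/imsetP; exists 1; rewrite ?group1 // cent11T setIT.
Qed.

(** The index counts the conjugates of 'C_G[x]; these are centralizers, and the
    centralizer G of 1 is not among them. *)
Lemma index_norm_cent1 (gT : finGroupType) (G : {group gT}) x :
    x \in G -> 'C_G[x] != G ->
  #|G : 'N_G('C_G[x])| < #|centralizers G|.
Proof.
move=> Gx ntCx; rewrite -card_conjugates; apply: proper_card.
apply/properP; split.
  apply/subsetP=> _ /imsetP[g Gg ->].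
  by rewrite cent1_conj // mem_centralizers ?groupJ.
exists (G : {set gT}); first exact: group_centralizers.
apply/negP=> /imsetP[g Gg defG]; case/eqP: ntCx.
by apply: (@conjsg_inj _ g); rewrite -defG conjGid.
Qed.

(** If y normalizes 'C_G[x], then x ^ y, which lies in its own centralizer
    'C_G[x ^ y] = 'C_G[x] :^ y, lies in 'C_G[x]. *)
Lemma engel2_norm_cent1 (gT : finGroupType) (G K : {group gT}) :
    K \subset G -> {in K, forall x, K \subset 'N('C_G[x])} -> engel2 K.
Proof.
move=> sKG nK x y Kx Ky; have [Gx Gy] := (subsetP sKG _ Kx, subsetP sKG _ Ky).
apply: commute_sym; apply/cent1P.
have : x ^ y \in 'C_G[x ^ y] by rewrite inE groupJ // cent1id.
by rewrite -cent1_conj // (normP (subsetP (nK x Kx) y Ky)) => /setIP[].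
Qed.

Lemma pgroup_der_centralizers (gT : finGroupType) (P : {group gT}) q k :
    prime q -> q.-group P -> #|centralizers P| <= q ^ k.+1 ->
  P^`(k.+2) = 1.
Proof.
move=> q_pr qP leP; have EK : engel2 P^`(k).
  apply: (@engel2_norm_cent1 _ P); first exact: der_sub.
  move=> x /(subsetP (der_sub k P)) Px.
  have [-> | ntCx] := eqVneq 'C_P[x] P.
    exact: subset_trans (der_sub k P) (normG P).
  have : P^`(k) \subset 'N_P('C_P[x]).
    apply: (der_sub_index q_pr qP); first exact: subsetIl.
    exact: leq_trans (index_norm_cent1 Px ntCx) leP.
  by rewrite subsetI => /andP[].
by have := engel2_metabelian EK; rewrite /= !dergSn.
Qed.

(** For noncommuting x and y, the q centralizers of the elements x * y ^+ i with
    i < q are proper and pairwise distinct: two of these elements that commute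
    also commute with their quotient y ^+ (j - i), which generates <[y]>, hence
    with y, which is impossible. With P itself this makes q + 1 centralizers. *)
Lemma pgroup_leq_centralizers (gT : finGroupType) (P : {group gT}) q :
    prime q -> q.-group P -> ~~ abelian P -> q < #|centralizers P|.
Proof.
move=> q_pr qP /centsP-nabP.
have /existsP[x /existsP[y /and3P[Px Py ncxy]]] :
    [exists x, exists y, [&& x \in P, y \in P & x * y != y * x]].
  apply: contraT; rewrite negb_exists => /forallP-cP; case: nabP => x Px y Py.
  have := cP x; rewrite negb_exists => /forallP/(_ y).
  by rewrite Px Py /= negbK => /eqP.
(* None stands for the centralizer P of 1. *)
pose f (o : option 'I_q) :=
  if o is Some i then 'C_P[x * y ^+ i] else P : {set gT}.
have ncy (i : nat) : x * y ^+ i \notin 'C[y].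
  apply: contra ncxy => /cent1P cxyi; apply/eqP.
  have cyX : commute y (y ^- i) by apply/commuteV/commuteX.
  by have := commuteM (commute_sym cxyi) cyX; rewrite mulgK => /commute_sym.
have f_inj : injective f.
  have PxyX (i : nat) : x * y ^+ i \in P by rewrite groupM ?groupX.
  have cSome (i j : 'I_q) : i <= j -> f (Some i) = f (Some j) -> i = j.
    move=> leij /= eqC; apply/val_inj/eqP; rewrite eqn_leq leij /= leqNgt.
    apply: contra (ncy j) => ltij; apply/cent1P.
    have cz : x * y ^+ i \in 'C[x * y ^+ j].
      have : x * y ^+ i \in 'C_P[x * y ^+ i] by rewrite inE PxyX cent1id.
      by rewrite eqC => /setIP[].
    have cyd : y ^+ (j - i) \in 'C[x * y ^+ j].
      rewrite -(mulKg (x * y ^+ i) (y ^+ (j - i))) -mulgA -expgD subnKC //.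
      by rewrite groupM ?groupV ?cent1id.
    have gen_y : generator <[y]> (y ^+ (j - i)).
      rewrite generator_coprime (pnat_coprime (mem_p_elt qP Py)) //.
      rewrite p'natE // gtnNdvd ?subn_gt0 //.
      exact: leq_ltn_trans (leq_subr _ _) (ltn_ord j).
    have : <[y]> \subset 'C[x * y ^+ j] by rewrite (eqP gen_y) cycle_subG.
    by rewrite cycle_subG => /cent1P.
  case=> [i|] [j|] //.
  - case: (leqP i j) => [leij | /ltnW leji] eqC; congr Some; first exact: cSome.
    by apply: esym; apply: cSome.
  - move=> /= eqC; case/negP: (ncy i).
    by move: Py; rewrite -eqC => /setIP[_ /cent1P cy]; apply/cent1P.
  - move=> /= eqC; case/negP: (ncy j).
    by move: Py; rewrite eqC => /setIP[_ /cent1P cy]; apply/cent1P.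
rewrite -[q]card_ord -(card_option 'I_q) -(card_imset _ f_inj).
apply: subset_leq_card.
apply/subsetP=> _ /imsetP[[i|] _ ->]; last exact: group_centralizers.
by rewrite mem_centralizers ?groupM ?groupX.
Qed.

(** * Nilpotent groups *)

(** For h in H and k in K, the centralizer of h * k meets H in 'C_H[h], because
    k centralizes H, and meets K in 'C_K[k]: thus C |-> (C :&: H, C :&: K) sends
    centralizers of G onto all pairs of centralizers. *)
Lemma leq_mul_centralizers (gT : finGroupType) (G H K : {group gT}) :
    H \subset G -> K \subset G -> K \subset 'C(H) ->
  #|centralizers H| * #|centralizers K| <= #|centralizers G|.
Proof.
move=> sHG sKG cHK; rewrite -cardsX.
apply: leq_trans (leq_imset_card (fun C => (C :&: H, C :&: K)) _).
apply/subset_leq_card/subsetP=> -[C D].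
move=> /setXP[/= /imsetP[h Hh ->] /imsetP[k Kk ->]].
have chk a b : a \in H -> b \in K -> b \in 'C[a].
  by move=> Ha Kb; apply/cent1P/(centsP cHK).
apply/imsetP; exists 'C_G[h * k].
  by rewrite mem_centralizers ?groupM ?(subsetP sHG h) ?(subsetP sKG k).
(* L is H or K in turn, and b the factor of h * k centralizing it. *)
have cut (L : {group gT}) a b : L \subset G -> L \subset 'C[b] ->
    'C_G[a * b] :&: L = 'C_L[a].
  move=> sLG cLb; apply/setP=> g; rewrite !in_setI.
  case Lg: (g \in L); rewrite ?andbF ?andbT //= (subsetP sLG) //=.
  have cgb : b \in 'C[g] by rewrite cent1C (subsetP cLb).
  by rewrite ![g \in _]cent1C groupMr.
congr (_, _); first by rewrite cut //; apply/subsetP=> g Hg; rewrite cent1C chk.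
by rewrite -(cent1P (chk _ _ Hh Kk)) cut //; apply/subsetP=> g Kg; rewrite chk.
Qed.

Lemma leq_centralizers (gT : finGroupType) (G H : {group gT}) :
  H \subset G -> #|centralizers H| <= #|centralizers G|.
Proof.
move=> sHG; apply: leq_trans (leq_mul_centralizers sHG (sub1G G) (sub1G _)).
by rewrite leq_pmulr //; apply/card_gt0P; exists 1; apply: group_centralizers.
Qed.

(** One prime at a time: 'O_q(G) and the pi-core for the other primes of s
    commute inside the pi-core for all the primes involved. *)
Lemma leq_prod_centralizers (gT : finGroupType) (G : {group gT}) (s : seq nat) :
    nilpotent G -> uniq s ->
  \prod_(q <- s) #|centralizers 'O_q(G)| <= #|centralizers G|.
Proof.
move=> nilG uniq_s.
apply: leq_trans (leq_centralizers (pcore_sub [pred q in s] G)).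
elim: s uniq_s => [|q s IHs] /=.
  rewrite big_nil => _; apply/card_gt0P.
  by exists 'O_[pred q in [::]](G); apply: group_centralizers.
case/andP=> s'q /IHs {}IHs; rewrite big_cons.
apply: leq_trans (leq_mul _ IHs) (leq_mul_centralizers _ _ _) => //.
- by apply: sub_pcore => r; rewrite !inE => ->.
- by apply: sub_pcore => r; rewrite !inE => ->; rewrite orbT.
apply: (sub_nilpotent_cent2 nilG); rewrite ?pcore_sub //.
apply: pnat_coprime (pcore_pgroup _ _) _.
apply: sub_pgroup (pcore_pgroup _ _) => r; rewrite !inE => sr.
by apply: contraNneq s'q => <-.
Qed.

(** G is the direct product of 'O_q(G) and 'O_q^'(G), so triviality of the
    derived subgroup of the first factor makes G^`(t) a q'-group; this for every
    prime q. *)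
Lemma nilpotent_der_eq1 (gT : finGroupType) (G : {group gT}) t :
    nilpotent G -> (forall q, prime q -> 'O_q(G)^`(t) = 1) -> G^`(t) = 1.
Proof.
move=> nilG derO; apply/eqP; rewrite trivg_card1; apply: contraT => ntGt.
have q_pr := pdiv_prime (_ : 1 < #|G^`(t)|).
have {}q_pr : prime (pdiv #|G^`(t)|).
  by rewrite q_pr // ltn_neqAle eq_sym ntGt cardG_gt0.
set q := pdiv _ in q_pr.
have := der_dprod t (nilpotent_pcoreC q nilG); rewrite derO // dprod1g => defGt.
have : q^'.-group G^`(t).
  by rewrite -defGt; apply: pgroupS (der_sub _ _) (pcore_pgroup _ _).
by rewrite /pgroup p'natE // pdiv_dvd.
Qed.

(** * From prime powers to logarithms *)

(** The index j realizing the derived length may be different from the index l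
    left out of the product; the factor N l then pays for the sharing of N j
    between p ^ k and a j + 1. *)
Lemma leq_prod_but_one (m k p : nat) (a N : 'I_m -> nat) (l j : 'I_m) :
    (forall i, p <= a i) -> (forall i, a i < N i) -> a j ^ k < N j ->
  p ^ k * \prod_(i | i != l) (a i).+1 <= \prod_i N i.
Proof.
move=> le_pa ltaN ltakN.
have le_pk : p ^ k <= a j ^ k by case: (k) => // k'; rewrite leq_exp2r.
rewrite [X in _ <= X](bigD1 l) //=.
have [jl | nejl] := eqVneq j l.
  by rewrite leq_mul ?leq_prod // -jl; apply: leq_trans le_pk (ltnW ltakN).
rewrite !(bigD1 (P := fun i => i != l) j) //= !mulnA leq_mul ?leq_prod //.
have ltpN : p < N l := leq_ltn_trans (le_pa l) (ltaN l).
case: k ltakN le_pk => [|k] ltakN le_pk.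
  by rewrite mul1n (leq_trans (ltaN j)) // leq_pmull // (leq_ltn_trans _ ltpN).
apply: leq_trans (leq_mul ltpN ltakN); rewrite mulnS mulSn.
rewrite leq_add //; first exact: leq_trans le_pk (leqnSn _).
rewrite {1}expnS -mulnA leq_mul // expnSr leqW // leq_mul //.
by case: (k) => // k'; rewrite leq_exp2r.
Qed.

Lemma floor_log_sum (R : realType) (I : finType) (P : pred I) (a : I -> nat)
    (p k n : nat) :
    1 < p -> (forall i, 0 < a i) -> p ^ k * \prod_(i | P i) a i <= n ->
  (k%:Z + \sum_(i | P i) Num.floor (log_base (p%:R : R) (a i)%:R)
     <= Num.floor (log_base (p%:R : R) n%:R))%R.
Proof.
move=> p_gt1 a_gt0 le_n; rewrite floor_ge_int.
have lnp : (0 < ln (p%:R : R))%R by rewrite ln_gt0 // ltr1n.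
have p0 : 0 < p by exact: ltnW.
have pa0 : 0 < \prod_(i | P i) a i by rewrite prodn_cond_gt0.
have lnprod :
    (ln ((\prod_(i | P i) a i)%N%:R : R) = \sum_(i | P i) ln (a i)%:R)%R.
  elim/big_rec2: _ (pa0) => [|i x y Pi IH]; first by rewrite ln1.
  rewrite muln_gt0 => /andP[_ y0].
  by rewrite natrM lnM ?posrE ?ltr0n // IH.
rewrite rmorphD /= raddf_sum /=.
pose x : R := ((p ^ k * \prod_(i | P i) a i)%:R)%R.
apply: (@le_trans _ _ (log_base p%:R x)); rewrite /x; last first.
  rewrite ler_pM2r ?invr_gt0 // ler_ln ?posrE ?ltr0n ?ler_nat //.
    by rewrite muln_gt0 expn_gt0 p0.
  by apply: leq_trans le_n; rewrite muln_gt0 expn_gt0 p0.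
rewrite /log_base natrM lnM ?posrE ?ltr0n ?expn_gt0 ?p0 // natrX lnXn ?ltr0n //.
rewrite mulrDl mulrnAl mulfV ?gt_eqF // lerD //.
rewrite lnprod mulr_suml ler_sum // => i _; exact: floor_le.
Qed.

(** * The bound on the derived length *)

Theorem theorem4p1 (R : realType) (gT : finGroupType) (G : {group gT})
    (n m : nat) (ps : 'I_m -> nat) (p : nat)
    (nabG : ~~ abelian G) (nilG : nilpotent G)
    (centG : #|centralizers G| = n)
    (ps_inj : injective ps)
    (psP : forall q : nat,
       (exists i : 'I_m, ps i = q) <-> has_nonabelian_Sylow G q)
    (p_mem : exists i : 'I_m, ps i = p)
    (p_min : forall i : 'I_m, (p <= ps i)%N) :
  ((derived_length G)%:Z
     <= 2 + Num.floor (log_base (p%:R : R) n%:R)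
        - \sum_(i < m | (i.+1 < m)%N)
            Num.floor (log_base (p%:R : R) (ps i + 1)%:R))%R.
Proof.
have SylG i : prime (ps i) /\ ~~ abelian 'O_(ps i)(G).
  have [q_pr [P [sylP nabP]]] : has_nonabelian_Sylow G (ps i).
    by apply/psP; exists i.
  by rewrite -(nilpotent_Hall_pcore nilG sylP).
pose N i := #|centralizers 'O_(ps i)(G)|.
have ltpsN i : ps i < N i.
  have [q_pr nabO] := SylG i.
  exact: pgroup_leq_centralizers q_pr (pcore_pgroup _ _) nabO.
pose k i := trunc_log (ps i) (N i).-1.
have kP i : ps i ^ k i < N i /\ N i <= ps i ^ (k i).+1.
  have [q_pr _] := SylG i; have N_gt1 : 1 < N i.
    exact: leq_ltn_trans (prime_gt0 q_pr) (ltpsN i).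
  have defN : (N i).-1.+1 = N i by rewrite prednK ?(ltnW N_gt1).
  have N1_gt0 : 0 < (N i).-1 by rewrite -ltnS defN.
  have /andP[] := trunc_log_bounds (prime_gt1 q_pr) N1_gt0.
  by rewrite -ltnS !defN.
have [i0 psi0] := p_mem; pose j := [arg max_(i > i0) k i].
have maxk i : k i <= k j by rewrite /j; case: arg_maxnP => // j' _; apply.
have derG : G^`((k j).+2) = 1.
  apply: nilpotent_der_eq1 => // q q_pr.
  have solO : solvable 'O_q(G).
    exact: solvableS (pcore_sub q G) (nilpotent_sol nilG).
  have [abO | nabO] := boolP (abelian 'O_q(G)).
    apply/(der_lengthP solO); apply: (@leq_trans 1) => //.
    exact/(der_lengthP solO)/derG1P.
  have [i psi] : exists i, ps i = q.
    apply/psP; split=> //; exists 'O_q(G)%G; split=> //.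
    exact: nilpotent_pcore_Hall.
  have [_ leN] := kP i; rewrite -psi in solO *.
  apply/(der_lengthP solO); apply: (@leq_trans (k i).+2).
    apply/(der_lengthP solO).
    exact: (pgroup_der_centralizers (SylG i).1 (pcore_pgroup _ _) leN).
  by rewrite !ltnS.
have dlG : derived_length G <= (k j).+2.
  by apply/(der_lengthP (nilpotent_sol nilG)).
have m_gt0 : 0 < m := leq_ltn_trans (leq0n _) (ltn_ord i0).
have lt_l_m : m.-1 < m by rewrite prednK.
pose l := Ordinal lt_l_m.
have pred_l (i : 'I_m) : (i.+1 < m) = (i != l).
  by rewrite ltn_neqAle ltn_ord andbT -val_eqE /= -[(i : nat) == _]eqSS prednK.
have p_pr : prime p by rewrite -psi0; case: (SylG i0).
have leN : p ^ k j * \prod_(i < m | i != l) (ps i).+1 <= n.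
  apply: leq_trans (leq_prod_but_one _ p_min ltpsN (kP j).1) _.
  have := leq_prod_centralizers nilG (_ : uniq (map ps (enum 'I_m))).
  rewrite centG big_map big_enum /=; apply.
  by rewrite map_inj_uniq ?enum_uniq.
have := @floor_log_sum R _ _ _ _ _ _ (prime_gt1 p_pr)
          (fun i => ltn0Sn (ps i)) leN.
have -> : (\sum_(i < m | (i.+1 < m)%N)
            Num.floor (log_base (p%:R : R) (ps i + 1)%:R)
    = \sum_(i < m | i != l)
            Num.floor (log_base (p%:R : R) (ps i).+1%:R))%R.
  by apply: eq_big => [i | i _]; rewrite ?pred_l ?addn1.
move=> lefl; apply: (@le_trans _ _ (k j).+2%:Z%R); first by rewrite lez_nat.
by rewrite -[(k j).+2]add2n PoszD lerBrDr -addrA lerD2l.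
Qed.
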